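(* Let $m$, $n$ and $q$ be positive integers. Then \[ \sum_{k = 1}^\infty \frac{L_{nk+mnq}}{F_{nk+mnq}\,\prod_{j=0}^{m-1} F_{nk+jnq}^2\,\prod_{j=m+1}^{2m}F_{nk+jnq}^2} = \frac{1}{F_{2mnq}}\sum_{k=1}^{q}\prod_{j=0}^{2m-1}\frac{1}{F_{nk+jnq}^2}. \]
   Context: The Fibonacci numbers are defined by $F_0=0$, $F_1=1$, $F_n=F_{n-1}+F_{n-2}$, and the Lucas numbers by $L_0=2$, $L_1=1$, $L_n=L_{n-1}+L_{n-2}$. Infinite sums are limits of partial sums. *)

(* Defs.v *)
From HB Require Import structures.
From mathcomp Require Import all_boot all_order all_algebra.
From mathcomp Require Import all_classical all_reals all_analysis.

Set Implicit Arguments.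
Unset Strict Implicit.
Unset Printing Implicit Defensive.

Local Open Scope nat_scope.

Fixpoint fib (n : nat) : nat :=
  match n with
  | 0 => 0
  | 1 => 1
  | (n2.+1 as n1).+1 => fib n1 + fib n2
  end.

Fixpoint lucas (n : nat) : nat :=
  match n with
  | 0 => 2
  | 1 => 1
  | (n2.+1 as n1).+1 => lucas n1 + lucas n2
  end.

(* Main.v *)
Require Import Defs.
From HB Require Import structures.
From mathcomp Require Import all_boot all_order all_algebra.
From mathcomp Require Import all_classical all_reals all_analysis.
From mathcomp Require Import zify ring.

(* Let f k = \prod_(j < 2m) F_(nk+jnq)^-2. Shifting k by q shifts j by one, so
   f k - f (k+q) is (F_(nk+2mnq)^2 - F_(nk)^2) / \prod_(j <= 2m) F_(nk+jnq)^2.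
   Since F_(a+2b)^2 - F_a^2 = F_(2(a+b)) F_(2b) and F_(2c) = F_c L_c, this is
   F_(2mnq) times the k-th summand; the series telescopes with step q, and
   f k -> 0. *)

Set Implicit Arguments.
Unset Strict Implicit.
Unset Printing Implicit Defensive.

Import Order.TTheory GRing.Theory Num.Theory.
Import numFieldNormedType.Exports.

Local Open Scope classical_set_scope.
Local Open Scope ring_scope.

Lemma fibSS k : fib k.+2 = (fib k.+1 + fib k)%N.
Proof. by []. Qed.

Lemma lucasSS k : lucas k.+2 = (lucas k.+1 + lucas k)%N.
Proof. by []. Qed.

Lemma fib_gt0 k : (0 < k)%N -> (0 < fib k)%N.
Proof.
case: k => // k _; elim: k => // k IHk.
by rewrite fibSS addn_gt0 IHk.
Qed.

Lemma fib_leS k : (fib k <= fib k.+1)%N.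
Proof. by case: k => // k; rewrite fibSS leq_addr. Qed.

Lemma leq_fib : {homo fib : i j / (i <= j)%N}.
Proof. by apply: homo_leq => [//|? ? ?|]; [exact: leq_trans | exact: fib_leS]. Qed.

(** Linear growth is enough to send the reciprocals to 0; the shift by two makes the bound strict
    from [k = 0] on. *)
Lemma ltn_fibSS k : (k < fib k.+2)%N.
Proof.
elim: k => // k IHk; rewrite fibSS.
have := @fib_gt0 k.+1 isT; lia.
Qed.

Section FibonacciIdentities.
Variable R : comNzRingType.
Local Notation F k := ((fib k)%:R : R).

Lemma fibSSr k : F k.+2 = F k.+1 + F k.
Proof. by rewrite fibSS natrD. Qed.

(** The difference [F b.+1 - F b] plays the role of F_(b-1), which also covers [b = 0]. Induction
    needs two consecutive values of [b] at once. *)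
Lemma fib_addr a b : F (a + b) = F a.+1 * F b + F a * (F b.+1 - F b).
Proof.
suff [] : F (a + b) = F a.+1 * F b + F a * (F b.+1 - F b) /\
  F (a + b.+1) = F a.+1 * F b.+1 + F a * (F b.+2 - F b.+1) by [].
elim: b => [|b [IH0 IH1]].
  by rewrite addn0 addn1 /=; split; ring.
split=> //; rewrite !addnS fibSSr -addnS IH0 IH1 !fibSSr; ring.
Qed.

Lemma fib_addSr a b : F (a + b).+1 = F a.+1 * F b.+1 + F a * F b.
Proof. by rewrite -addnS fib_addr fibSSr; ring. Qed.

(** Removes Lucas numbers, so that identities become polynomial in consecutive Fibonacci numbers and
    [ring] can decide them. *)
Lemma lucasr k : (lucas k)%:R = 2 * F k.+1 - F k.
Proof.
suff [] : (lucas k)%:R = 2 * F k.+1 - F k /\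
  (lucas k.+1)%:R = 2 * F k.+2 - F k.+1 by [].
elim: k => [|k [IH0 IH1]]; first by split; rewrite /=; ring.
by split=> //; rewrite lucasSS natrD IH0 IH1 !fibSSr; ring.
Qed.

(** The quadratic form equals (-1)^k, changing sign at each step; squaring removes the sign. *)
Lemma cassini_sqr k :
  (F k.+1 ^+ 2 - F k.+1 * F k - F k ^+ 2) ^+ 2 = 1.
Proof.
elim: k => [|k IHk]; first by rewrite /=; ring.
by rewrite -[RHS]IHk fibSSr; ring.
Qed.

Lemma fib_sqrB a b :
  F (a + (b + b)) ^+ 2 - F a ^+ 2 =
    F (a + b) * (lucas (a + b))%:R * F (b + b).
Proof.
(* After expansion every other term has degree 4 in [F b] and [F b.+1]; the Cassini factor, equal to
   1, brings this one to the same degree, and the identity becomes formal. *)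
have -> : F a ^+ 2 = F a ^+ 2 * (F b.+1 ^+ 2 - F b.+1 * F b - F b ^+ 2) ^+ 2.
  by rewrite cassini_sqr mulr1.
by rewrite lucasr !fib_addSr !fib_addr !fib_addSr; ring.
Qed.

End FibonacciIdentities.

(** Induction on [N]: the window of indices N+1, ..., N+q slides by one, losing [f N.+1] and gaining
    [f (N.+1 + q)]. No comparison of [N] with [q] is needed. *)
Lemma sum_telescope_step (V : zmodType) (q N : nat) (f : nat -> V) :
  \sum_(1 <= k < N.+1) (f k - f (k + q)%N) =
    \sum_(1 <= k < q.+1) f k - \sum_(1 <= k < q.+1) f (k + N)%N.
Proof.
elim: N => [|N IHN].
  by rewrite big_geq // [X in _ - X](eq_bigr f) ?subrr // => k _; rewrite addn0.
rewrite big_nat_recr //= {}IHN -addrA; congr (_ + _).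
have -> : \sum_(1 <= k < q.+1) f (k + N.+1)%N =
    \sum_(2 <= k < q.+2) f (k + N)%N.
  by rewrite [RHS]big_add1 /=; apply: eq_bigr => k _; rewrite addSnnS.
have E : f N.+1 + \sum_(2 <= k < q.+2) f (k + N)%N =
    \sum_(1 <= k < q.+1) f (k + N)%N + f (N.+1 + q)%N.
  rewrite [(N.+1 + q)%N]addSnnS addnC.
  by rewrite -(big_nat_recr _ _ (fun k => f (k + N)%N)) // [RHS]big_ltn.
have -> : \sum_(2 <= k < q.+2) f (k + N)%N =
    - f N.+1 + (\sum_(1 <= k < q.+1) f (k + N)%N + f (N.+1 + q)%N).
  by rewrite -E addKr.
by rewrite !opprD opprK addrCA.
Qed.

Section ReciprocalProduct.
Variables (R : realType) (m n q : nat).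
Hypotheses (m_gt0 : (0 < m)%N) (n_gt0 : (0 < n)%N).
Local Notation F k := ((fib k)%:R : R).

Let f k : R := \prod_(0 <= j < 2 * m) (1 / F (n * k + j * n * q) ^+ 2).

Lemma fibr_gt0 k j : (0 < k)%N -> 0 < F (n * k + j * n * q).
Proof. by move=> k_gt0; rewrite ltr0n fib_gt0 // addn_gt0 muln_gt0 n_gt0 k_gt0. Qed.

Lemma inv_fib_prod_cvg0 k : (fun N => f (k + N)%N) @ \oo --> (0 : R).
Proof.
rewrite (_ : (fun N => _) = (fun N => f (N + k)%N)); last first.
  by apply/funext => N; rewrite addnC.
(* The offset [k] is traded for 2: then the factor [j = 0] is at most 1/(N+1), since F_(N+2) > N,
   and all other factors are at most 1. *)
rewrite (cvg_shiftn k f) -(cvg_shiftn 2 f).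
apply: (@squeeze_cvgr _ _ _ _ (fun=> 0) harmonic).
- apply: nearW => N; rewrite /= addn2; apply/andP; split.
    by apply: prodr_ge0 => j _; rewrite divr_ge0 ?sqr_ge0.
  rewrite /f big_ltn ?muln_gt0 // mul0n mul0n addn0 -[leRHS]mulr1 /harmonic.
  have F_ge1 j : 1 <= F (n * N.+2 + j * n * q) ^+ 2.
    by rewrite exprn_ege1 // ler1n -(ltr0n R) fibr_gt0.
  apply: ler_pM; rewrite ?prodr_ge0 ?divr_ge0 ?sqr_ge0 //.
  + rewrite div1r lef_pV2 ?posrE ?ltr0n ?exprn_gt0 ?ltr0n ?fib_gt0 ?muln_gt0 ?n_gt0 //.
    rewrite -natrX ler_nat.
    apply: leq_trans (ltn_fibSS N) _.
    apply: leq_trans (leq_fib (leq_pmull N.+2 n_gt0)) _.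
    by rewrite -[leqLHS]expn1 leq_pexp2l // fib_gt0 // muln_gt0 n_gt0.
  + rewrite prodr_ile1 // => j _.
    by rewrite divr_ge0 ?sqr_ge0 //= div1r invf_le1 // (lt_le_trans ltr01).
- exact: cvg_cst.
- exact: cvg_harmonic.
Qed.

Lemma inv_fib_prod_step k : (0 < k)%N ->
  f k - f (k + q)%N = F (2 * m * n * q) *
    ((lucas (n * k + m * n * q))%:R /
     (F (n * k + m * n * q) *
      (\prod_(0 <= j < m) F (n * k + j * n * q) ^+ 2) *
      (\prod_(m.+1 <= j < (2 * m).+1) F (n * k + j * n * q) ^+ 2))).
Proof.
move=> k_gt0; pose G j := F (n * k + j * n * q).
have G_neq0 j : G j != 0 by rewrite gt_eqF ?fibr_gt0.
have fkq : f (k + q)%N = \prod_(1 <= j < (2 * m).+1) (1 / G j ^+ 2).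
  rewrite big_add1 /f /=; apply: eq_bigr => j _.
  by rewrite /G mulSn mulnDr -addnA mulnDl.
have prodV a b : \prod_(a <= j < b) (1 / G j ^+ 2) = (\prod_(a <= j < b) G j ^+ 2)^-1.
  by rewrite -prodfV; apply: eq_bigr => j _; rewrite div1r.
have prod_neq0 a b : \prod_(a <= j < b) G j ^+ 2 != 0.
  by rewrite prodf_seq_neq0; apply/allP => j _ /=; rewrite expf_neq0.
(* The square identity with a = nk and b = mnq, so that a, a+b, a+2b are the indices of [G] at 0, m,
   2m. *)
have sqrB : G (2 * m)%N ^+ 2 - G 0%N ^+ 2 =
    G m * (lucas (n * k + m * n * q))%:R * F (2 * m * n * q).
  have := fib_sqrB R (n * k) (m * n * q).
  by rewrite /G addnn -mul2n !mulnA mul0n addn0.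
set P := \prod_(0 <= j < m) _; set Q := \prod_(m.+1 <= j < _) _.
have split_prod : \prod_(0 <= j < (2 * m).+1) G j ^+ 2 = P * G m ^+ 2 * Q.
  by rewrite (@big_cat_nat _ _ _ m) //= ?[X in _ * X]big_ltn ?mulrA //; lia.
(* Over the common product for j = 0, ..., 2m, [f k] lacks the last factor and [f (k + q)] the
   first. The middle factor is isolated because [sqrB] cancels one of its two powers. *)
have fk : f k = G (2 * m)%N ^+ 2 / (P * G m ^+ 2 * Q).
  rewrite [f k]prodV -split_prod big_nat_recr //=.
  by field; rewrite G_neq0 prod_neq0.
have {}fkq : f (k + q)%N = G 0%N ^+ 2 / (P * G m ^+ 2 * Q).
  rewrite fkq prodV -split_prod [in RHS]big_ltn //=.
  by field; rewrite G_neq0 prod_neq0.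
rewrite fk fkq -mulrBl sqrB; have := prod_neq0 0%N m; have := prod_neq0 m.+1 (2 * m).+1.
rewrite -/P -/Q -/(G m) => Q_neq0 P_neq0; field.
by rewrite P_neq0 Q_neq0 G_neq0.
Qed.

End ReciprocalProduct.

Theorem corollary2p37 (R : realType) (m n q : nat)
    (hm : (0 < m)%N) (hn : (0 < n)%N) (hq : (0 < q)%N) :
  (fun N : nat => \sum_(1 <= k < N.+1)
     (lucas (n * k + m * n * q))%:R /
     ((fib (n * k + m * n * q))%:R *
      (\prod_(0 <= j < m) (fib (n * k + j * n * q))%:R ^+ 2) *
      (\prod_(m.+1 <= j < (2 * m).+1) (fib (n * k + j * n * q))%:R ^+ 2)) : R)
    @ \oo -->
  (1 / (fib (2 * m * n * q))%:R *
   \sum_(1 <= k < q.+1) \prod_(0 <= j < 2 * m)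
     (1 / (fib (n * k + j * n * q))%:R ^+ 2) : R).
Proof.
pose f k : R := \prod_(0 <= j < 2 * m)
  (1 / (fib (n * k + j * n * q))%:R ^+ 2).
have F_neq0 : (fib (2 * m * n * q))%:R != 0 :> R.
  by rewrite pnatr_eq0 -lt0n fib_gt0 // !muln_gt0 hm hn hq.
rewrite (_ : (fun N => _) = (fun N => 1 / (fib (2 * m * n * q))%:R *
    (\sum_(1 <= k < q.+1) f k - \sum_(1 <= k < q.+1) f (k + N)%N))); last first.
  apply/funext => N; rewrite -sum_telescope_step mulr_sumr.
  apply: eq_big_nat => k /andP[k_gt0 _].
  by rewrite inv_fib_prod_step // div1r mulKf.
apply: cvgMl_tmp; rewrite -[X in _ --> X]subr0.
apply: cvgB; first exact: cvg_cst.
(* The remainder has a fixed number [q] of terms, each tending to 0; the limit is written as a sum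
   of zeros to pass termwise. *)
have : (fun N => \sum_(1 <= k < q.+1) f (k + N)%N) @ \oo -->
    (\sum_(1 <= k < q.+1) 0 : R); last by rewrite big1_eq.
apply: cvg_big => [|k _]; first exact: add_continuous.
exact: inv_fib_prod_cvg0.
Qed.
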